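(* Let $(\mathcal{A},[\cdot,\cdot],\mu,\alpha)$ be a Hom-Poisson superalgebra, let $V$ be a $\mathbb{Z}_2$-graded vector space with an even linear map $\alpha_V:V\to V$, and let $\rho,\eta:\mathcal{A}\to \mathrm{End}(V)$ be two even linear maps. Then $(V,\rho,\eta,\alpha_V)$ is a representation of $(\mathcal{A},[\cdot,\cdot],\mu,\alpha)$ if and only if $(\mathcal{A}\oplus V,[\cdot,\cdot]_{\mathcal{A}\oplus V},\mu_{\mathcal{A}\oplus V},\alpha+\alpha_V)$ is a Hom-Poisson superalgebra, where for all homogeneous $x+u,\,y+v\in\mathcal{A}\oplus V$ (with $x,y\in\mathcal{A}$, $u,v\in V$) $$\mu_{\mathcal{A}\oplus V}(x+u,y+v)=\mu(x,y)+\eta(x)v+(-1)^{|y||u|}\eta(y)u,$$ $$[x+u,y+v]_{\mathcal{A}\oplus V}=[x,y]+\rho(x)v-(-1)^{|y||u|}\rho(y)u,$$ $$(\alpha+\alpha_V)(x+u)=\alpha(x)+\alpha_V(u).$$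
   Context: $\mathbb{K}$ is a field of characteristic zero; all vector spaces are $\mathbb{Z}_2$-graded over $\mathbb{K}$; $|x|$ denotes the parity of a homogeneous element $x$. Even (multi)linear maps preserve the grading. Identities are required for all homogeneous elements. $\mathcal{A}\oplus V$ is graded by $(\mathcal{A}\oplus V)_i=\mathcal{A}_i\oplus V_i$, so a homogeneous $x+u$ has $|x+u|=|x|=|u|$. A Hom-associative superalgebra $(\mathcal{A},\mu,\alpha)$: $\alpha$ even linear, $\mu$ even bilinear, with $\mu(\mu(x,y),\alpha(z))=\mu(\alpha(x),\mu(y,z))$; commutative if $\mu(x,y)=(-1)^{|x||y|}\mu(y,x)$. A Hom-Lie superalgebra $(\mathcal{A},[\cdot,\cdot],\alpha)$: $\alpha$ even linear, $[\cdot,\cdot]$ even bilinear, with $[x,y]=-(-1)^{|x||y|}[y,x]$ and $[\alpha(x),[y,z]]=[[x,y],\alpha(z)]+(-1)^{|x||y|}[\alpha(y),[x,z]]$. A Hom-Poisson superalgebra $(\mathcal{A},[\cdot,\cdot],\mu,\alpha)$: $(\mathcal{A},[\cdot,\cdot],\alpha)$ is a Hom-Lie superalgebra, $(\mathcal{A},\mu,\alpha)$ is a commutative Hom-associative superalgebra, and $[\alpha(x),\mu(y,z)]=\mu([x,y],\alpha(z))+(-1)^{|x||y|}\mu(\alpha(y),[x,z])$. A representation of a Hom-Poisson superalgebra $(\mathcal{A},[\cdot,\cdot],\mu,\alpha)$ is a quadruple $(V,\rho,\eta,\alpha_V)$ with $V$ a $\mathbb{Z}_2$-graded vector space, $\alpha_V:V\to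 V$ and $\rho,\eta:\mathcal{A}\to\mathrm{End}(V)$ even linear maps, such that for all homogeneous $x,y\in\mathcal{A}$: (1) $\eta(\mu(x,y))\alpha_V=\eta(\alpha(x))\eta(y)$ and $\eta(\alpha(x))\eta(y)=(-1)^{|x||y|}\eta(\alpha(y))\eta(x)$ (i.e. $(V,\eta,\alpha_V)$ is a representation of the commutative Hom-associative superalgebra $(\mathcal{A},\mu,\alpha)$); (2) $\rho([x,y])\alpha_V=\rho(\alpha(x))\rho(y)-(-1)^{|x||y|}\rho(\alpha(y))\rho(x)$ (i.e. $(V,\rho,\alpha_V)$ is a representation of the Hom-Lie superalgebra); (3) $\eta([x,y])\alpha_V=\rho(\alpha(x))\eta(y)-(-1)^{|x||y|}\eta(\alpha(y))\rho(x)$ and $\rho(\mu(x,y))\alpha_V=\eta(\alpha(x))\rho(y)+(-1)^{|x||y|}\eta(\alpha(y))\rho(x)$. *)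

(* Defs.v *)
From HB Require Import structures.
From mathcomp Require Import all_boot all_order all_algebra.

Set Implicit Arguments.
Unset Strict Implicit.
Unset Printing Implicit Defensive.

Import GRing.Theory.
Local Open Scope ring_scope.

(* Parities are booleans: [false] is the even degree, [true] the odd one, and
   [addb] is the addition of Z_2.  [homog i] is the component of degree i of
   V = V_0 (+) V_1; the zero vector is homogeneous of both degrees. *)
HB.mixin Record isSuperLmodule (K : fieldType) V of GRing.Lmodule K V := {
  homog : bool -> {pred V};
  homog_submod_closed : forall i, submod_closed (homog i);
  homog_span : forall v : V,
    exists v0 v1, [/\ v0 \in homog false, v1 \in homog true & v = v0 + v1];
  homog_disjoint : forall v : V, v \in homog false -> v \in homog true -> v = 0
}.

#[short(type="superLmodType")]
HB.structure Definition SuperLmodule (K : fieldType) :=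
  {V of GRing.Lmodule K V & isSuperLmodule K V}.

Section HomogeneousParts.
Variables (K : fieldType) (V : superLmodType K).
Implicit Types (u v : V) (i j : bool).

Lemma homog0 i : (0 : V) \in homog i.
Proof. by have [] := homog_submod_closed (s := V) i. Qed.

Lemma homogD i u v : u \in homog i -> v \in homog i -> u + v \in homog i.
Proof.
have [_ lin] := homog_submod_closed (s := V) i.
by move=> hu hv; have := lin 1 u v hu hv; rewrite scale1r.
Qed.

Lemma homogZ i (a : K) v : v \in homog i -> a *: v \in homog i.
Proof.
have [h0 lin] := homog_submod_closed (s := V) i.
by move=> hv; have := lin a v 0 hv h0; rewrite addr0.
Qed.

Lemma homogB i u v : u \in homog i -> v \in homog i -> u - v \in homog i.
Proof. by move=> hu hv; rewrite -scaleN1r homogD ?homogZ. Qed.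

Lemma even_part_subproof v :
  exists u, (u \in homog false) && (v - u \in homog true).
Proof.
have [v0 [v1 [h0 h1 ->]]] := homog_span v.
by exists v0; rewrite h0 addrAC subrr add0r.
Qed.

Definition part i v : V :=
  let v0 := xchoose (even_part_subproof v) in if i then v - v0 else v0.

Lemma part_homog i v : part i v \in homog i.
Proof.
by rewrite /part; case/andP: (xchooseP (even_part_subproof v)); case: i.
Qed.

Lemma sum_part v : \sum_i part i v = v.
Proof. by rewrite big_bool /= /part subrK. Qed.

Lemma part_id i j v : v \in homog i -> part j v = if j == i then v else 0.
Proof.
move=> hv; have E : part true v + part false v = v.
  by have := sum_part v; rewrite big_bool.
have h1 := part_homog true v; have h0 := part_homog false v.
case: i hv => hv.
- have z0 : part false v = 0.
    apply: homog_disjoint => //.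
    by rewrite -[part false v](addKr (part true v)) E addrC homogB.
  by case: j; rewrite // -[RHS]E z0 addr0.
- have z1 : part true v = 0.
    apply: homog_disjoint => //.
    by rewrite -[part true v](addrK (part false v)) E homogB.
  by case: j; rewrite // -[RHS]E z1 add0r.
Qed.

End HomogeneousParts.

Section DirectSum.
Variables (K : fieldType) (A V : superLmodType K).

Definition prod_homog i : {pred A * V} :=
  [pred p | (p.1 \in homog i) && (p.2 \in homog i)].

Lemma prod_homog_submod_closed i : submod_closed (prod_homog i).
Proof.
split; first by rewrite inE /= !homog0.
move=> a p q /andP[p1 p2] /andP[q1 q2].
by rewrite inE /= !homogD ?homogZ.
Qed.

Lemma prod_homog_span (p : A * V) :
  exists p0 p1,
    [/\ p0 \in prod_homog false, p1 \in prod_homog true & p = p0 + p1].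
Proof.
exists (part false p.1, part false p.2), (part true p.1, part true p.2).
split; [by apply/andP; rewrite !part_homog | by apply/andP; rewrite !part_homog |].
have E (W : superLmodType K) (w : W) : w = part false w + part true w.
  by rewrite addrC -[LHS]sum_part big_bool.
by apply: injective_projections; apply: E.
Qed.

Lemma prod_homog_disjoint (p : A * V) :
  p \in prod_homog false -> p \in prod_homog true -> p = 0.
Proof.
case: p => x v /andP[/= x0 v0] /andP[/= x1 v1].
by rewrite (homog_disjoint _ x0 x1) (homog_disjoint _ v0 v1).
Qed.

HB.instance Definition _ := isSuperLmodule.Build K (A * V)%type
  prod_homog_submod_closed prod_homog_span prod_homog_disjoint.

End DirectSum.

(* (-1)^{|x||y|} for x of degree i and y of degree j. *)
Notation ssign i j := ((-1) ^+ (nat_of_bool i * nat_of_bool j)%N).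

Section Superalgebras.
Variables (K : fieldType) (A : superLmodType K).
Implicit Types (br mu : A -> A -> A) (alpha : A -> A).

Definition even_linear (V : superLmodType K) (f : V -> V) : Prop :=
  linear f /\ forall i v, v \in homog i -> f v \in homog i.

Definition even_bilinear mu : Prop :=
  [/\ forall x, linear (mu x),
      forall y, linear (mu^~ y)
    & forall i j x y, x \in homog i -> y \in homog j ->
        mu x y \in homog (i (+) j)].

Definition homAssociative_superalgebra mu alpha : Prop :=
  [/\ even_linear alpha, even_bilinear mu
    & forall i j k x y z, x \in homog i -> y \in homog j -> z \in homog k ->
        mu (mu x y) (alpha z) = mu (alpha x) (mu y z)].

Definition supercommutative mu : Prop :=
  forall i j x y, x \in homog i -> y \in homog j ->
    mu x y = ssign i j *: mu y x.

Definition homLie_superalgebra br alpha : Prop :=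
  [/\ even_linear alpha, even_bilinear br,
      forall i j x y, x \in homog i -> y \in homog j ->
        br x y = - (ssign i j *: br y x)
    & forall i j k x y z, x \in homog i -> y \in homog j -> z \in homog k ->
        br (alpha x) (br y z)
        = br (br x y) (alpha z) + ssign i j *: br (alpha y) (br x z)].

Definition homPoisson_superalgebra br mu alpha : Prop :=
  [/\ homLie_superalgebra br alpha,
      homAssociative_superalgebra mu alpha,
      supercommutative mu
    & forall i j k x y z, x \in homog i -> y \in homog j -> z \in homog k ->
        br (alpha x) (mu y z)
        = mu (br x y) (alpha z) + ssign i j *: mu (alpha y) (br x z)].

End Superalgebras.

Section Representations.
Variables (K : fieldType) (A V : superLmodType K).
Implicit Types (br mu : A -> A -> A) (alpha : A -> A) (alphaV : V -> V).
Implicit Types (rho eta : A -> {linear V -> V}).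

Definition End_homog (i : bool) (f : {linear V -> V}) : Prop :=
  forall j v, v \in homog j -> f v \in homog (i (+) j).

(* Even linear maps A -> End(V), with the pointwise vector space structure
   on End(V) and the grading [End_homog]. *)
Definition even_linear_End rho : Prop :=
  (forall v, linear (fun x => rho x v)) /\
  forall i x, x \in homog i -> End_homog i (rho x).

Definition homAssociative_representation mu alpha eta alphaV : Prop :=
  [/\ even_linear alphaV, even_linear_End eta,
      forall i j x y, x \in homog i -> y \in homog j -> forall v,
        eta (mu x y) (alphaV v) = eta (alpha x) (eta y v)
    & forall i j x y, x \in homog i -> y \in homog j -> forall v,
        eta (alpha x) (eta y v) = ssign i j *: eta (alpha y) (eta x v)].

Definition homLie_representation br alpha rho alphaV : Prop :=
  [/\ even_linear alphaV, even_linear_End rho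
    & forall i j x y, x \in homog i -> y \in homog j -> forall v,
        rho (br x y) (alphaV v)
        = rho (alpha x) (rho y v) - ssign i j *: rho (alpha y) (rho x v)].

Definition homPoisson_representation br mu alpha rho eta alphaV : Prop :=
  [/\ homAssociative_representation mu alpha eta alphaV,
      homLie_representation br alpha rho alphaV,
      forall i j x y, x \in homog i -> y \in homog j -> forall v,
        eta (br x y) (alphaV v)
        = rho (alpha x) (eta y v) - ssign i j *: eta (alpha y) (rho x v)
    & forall i j x y, x \in homog i -> y \in homog j -> forall v,
        rho (mu x y) (alphaV v)
        = eta (alpha x) (rho y v) + ssign i j *: eta (alpha y) (rho x v)].

(* The operations on A (+) V, where the pair (x, u) stands for x + u.  The
   defining formulas are for homogeneous arguments; they are extended
   biadditively by splitting u and y into their homogeneous parts.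
   [sum_mulE] and [sum_brE] recover the formulas. *)
Definition sum_mul mu eta (p q : A * V) : A * V :=
  (mu p.1 q.1,
   eta p.1 q.2
   + \sum_(i : bool) \sum_(j : bool)
       ssign j i *: eta (part j q.1) (part i p.2)).

Definition sum_br br rho (p q : A * V) : A * V :=
  (br p.1 q.1,
   rho p.1 q.2
   - \sum_(i : bool) \sum_(j : bool)
       ssign j i *: rho (part j q.1) (part i p.2)).

Definition sum_twist alpha alphaV (p : A * V) : A * V :=
  (alpha p.1, alphaV p.2).

Lemma sum_cross_homog eta : even_linear_End eta ->
  forall i j (u : V) (y : A), u \in homog i -> y \in homog j ->
  \sum_(i' : bool) \sum_(j' : bool)
     ssign j' i' *: eta (part j' y) (part i' u) = ssign j i *: eta y u.
Proof.
move=> [lin _] i j u y hu hy.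
have eta0 v : eta 0 v = 0.
  by have := lin v (-1) 0 0; rewrite scaler0 addr0 !scaleN1r addNr.
rewrite (bigD1 i) //= [X in _ + X]big1 => [|i' /negPf ni]; last first.
  by rewrite big1 // => j' _; rewrite (part_id _ hu) ni linear0 scaler0.
rewrite addr0 (bigD1 j) //= big1 => [|j' /negPf nj]; last first.
  by rewrite (part_id _ hy) nj eta0 scaler0.
by rewrite addr0 (part_id _ hu) (part_id _ hy) !eqxx.
Qed.

Lemma sum_mulE mu eta : even_linear_End eta ->
  forall i j (x y : A) (u v : V), (x, u) \in homog i -> (y, v) \in homog j ->
  sum_mul mu eta (x, u) (y, v) = (mu x y, eta x v + ssign j i *: eta y u).
Proof.
move=> h i j x y u v /andP[_ hu] /andP[hy _].
by rewrite /sum_mul /= (sum_cross_homog h hu hy).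
Qed.

Lemma sum_brE br rho : even_linear_End rho ->
  forall i j (x y : A) (u v : V), (x, u) \in homog i -> (y, v) \in homog j ->
  sum_br br rho (x, u) (y, v) = (br x y, rho x v - ssign j i *: rho y u).
Proof.
move=> h i j x y u v /andP[_ hu] /andP[hy _].
by rewrite /sum_br /= (sum_cross_homog h hu hy).
Qed.

End Representations.

(* Main.v *)
Require Import Defs.
From HB Require Import structures.
From mathcomp Require Import all_boot all_order all_algebra.
From mathcomp Require Import ring.

Set Implicit Arguments.
Unset Strict Implicit.
Unset Printing Implicit Defensive.

Import GRing.Theory.
Local Open Scope ring_scope.

(** Every axiom of a Hom-Poisson superalgebra on A (+) V splits into its
    A-component, which is the same axiom for A, and its V-component.  Since V
    multiplies V to zero, the V-component of a trilinear identity in x + u,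
    y + v, z + w is a sum of three independent slots, one linear in each of u,
    v, w, and each slot is an identity between endomorphisms of V.  Hence the
    axiom on A (+) V amounts to the slots: putting all but one of u, v, w equal
    to 0 isolates a slot, and adding the slots gives the axiom back.

    Both products on A (+) V have the same shape
      (x + u)(y + v) = f(x, y) + theta(x) v + c (-1)^{|y||u|} theta(y) u,
    with (f, theta, c) = (mu, eta, 1) or (br, rho, -1), where c is also the sign
    in the (super)symmetry of f.  Moreover the Hom-Jacobi and Hom-Leibniz
    identities are the same statement: bracketing with x is a twisted derivation
    of a second product f, which is the bracket itself or mu.  So two
    computations suffice: [semidirect_derivation], whose three slots reduce to
    two distinct conditions on (rho, theta), and [semidirect_associative].  For
    f = br the two conditions coincide with the Hom-Lie representation axiom;
    for f = mu they are the two compatibility conditions between rho and eta. *)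

(** * Linear maps and homogeneous elements *)

Section Homogeneous.
Variables (K : fieldType) (V : superLmodType K).

(** Used to pass from slots, available for homogeneous vectors only, to the
    representation axioms, which quantify over all vectors of V. *)
Lemma eq_on_homog (f g : {linear V -> V}) :
  (forall i v, v \in homog i -> f v = g v) -> f =1 g.
Proof.
move=> efg v; rewrite -(sum_part v) !linear_sum.
by apply: eq_bigr => i _; apply: efg (part_homog i v).
Qed.

Lemma subr_part i (v : V) : v - part i v = part (~~ i) v.
Proof.
apply/eqP; rewrite subr_eq -{1}(sum_part v) big_bool.
by case: i; rewrite // addrC.
Qed.

Lemma part_unique i (u v : V) :
  u \in homog i -> v - u \in homog (~~ i) -> part i v = u.
Proof.
move=> hu hvu; apply/eqP; rewrite -subr_eq0; apply/eqP.
have hi : part i v - u \in homog i by rewrite homogB ?part_homog.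
have hni : part i v - u \in homog (~~ i).
  have -> : part i v - u = (v - u) - (v - part i v).
    by rewrite opprB [RHS]addrC addrA subrK.
  by rewrite subr_part homogB ?part_homog.
by case: i hi hni {hu hvu} => ? ?; apply: homog_disjoint.
Qed.

Lemma part_linear i : linear (part i : V -> V).
Proof.
move=> a u v; apply: part_unique; first by rewrite homogD ?homogZ ?part_homog.
by rewrite opprD addrACA -scalerBr !subr_part homogD ?homogZ ?part_homog.
Qed.

End Homogeneous.

(** * The common shape of the two products on A (+) V *)

Section Semidirect.
Variables (K : fieldType) (A V : superLmodType K).
Implicit Types (f br mu : A -> A -> A) (theta rho eta : A -> {linear V -> V}).
Implicit Types (F G : A * V -> A * V -> A * V).

(** The biadditive extension of (-1)^{|y||u|} theta(y) u to arbitrary y and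
    u. *)
Definition cross theta (y : A) (u : V) : V :=
  \sum_(i : bool) \sum_(j : bool) ssign j i *: theta (part j y) (part i u).

Definition is_semidirect (c : K) f theta F : Prop :=
  forall p q, F p q = (f p.1 q.1, theta p.1 q.2 + c *: cross theta q.1 p.2).

Lemma sum_mul_semidirect mu eta : is_semidirect 1 mu eta (sum_mul mu eta).
Proof. by move=> p q; rewrite scale1r. Qed.

Lemma sum_br_semidirect br rho : is_semidirect (-1) br rho (sum_br br rho).
Proof. by move=> p q; rewrite scaleN1r. Qed.

Lemma cross_linearl theta u :
  even_linear_End theta -> linear (fun y => cross theta y u).
Proof.
move=> [lin _] a y z; rewrite /cross scaler_sumr -big_split /=.
apply: eq_bigr => i _; rewrite scaler_sumr -big_split /=.
apply: eq_bigr => j _.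
by rewrite part_linear lin scalerDr !scalerA mulrC.
Qed.

Lemma cross_linearr theta y : linear (cross theta y).
Proof.
move=> a u v; rewrite /cross scaler_sumr -big_split /=.
apply: eq_bigr => i _; rewrite scaler_sumr -big_split /=.
apply: eq_bigr => j _.
by rewrite part_linear linearP scalerDr !scalerA mulrC.
Qed.

Lemma semidirectE c f theta F :
    even_linear_End theta -> is_semidirect c f theta F ->
  forall i j (x y : A) (u v : V), (x, u) \in homog i -> (y, v) \in homog j ->
  F (x, u) (y, v) = (f x y, theta x v + (c * ssign j i) *: theta y u).
Proof.
move=> hth hF i j x y u v /andP[_ hu] /andP[hy _].
by rewrite hF /= /cross (sum_cross_homog hth hu hy) scalerA.
Qed.

Lemma semidirect_even_bilinear c f theta F :
    even_linear_End theta -> is_semidirect c f theta F ->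
  even_bilinear f -> even_bilinear F.
Proof.
move=> hth hF [linr linl hf]; have [lth gth] := hth; split.
- move=> p a q r; rewrite !hF; apply: injective_projections => /=.
    exact: linr.
  rewrite linearP (cross_linearl _ hth) !scalerDr !scalerA [c * a]mulrC.
  by rewrite addrACA.
- move=> q a p r; rewrite !hF; apply: injective_projections => /=.
    exact: linl.
  rewrite lth cross_linearr !scalerDr !scalerA [c * a]mulrC.
  by rewrite addrACA.
- move=> i j [x u] [y v] hp hq; rewrite (semidirectE hth hF hp hq).
  case/andP: hp hq => /= hx hu /andP[/= hy hv]; apply/andP; split=> /=.
    exact: hf.
  rewrite homogD ?homogZ //; first exact: gth.
  by rewrite addbC; apply: gth.
Qed.

(** With x + u and y + v exchanged, the two V-terms swap roles; they match
    because the square of the sign c (-1)^{|x||y|} is 1. *)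
Lemma semidirect_supersymmetric c f theta F :
    even_linear_End theta -> is_semidirect c f theta F -> c * c = 1 ->
    (forall i j x y, x \in homog i -> y \in homog j ->
       f x y = (c * ssign i j) *: f y x) ->
  forall i j p q, p \in homog i -> q \in homog j ->
    F p q = (c * ssign i j) *: F q p.
Proof.
move=> hth hF cc symf i j [x u] [y v] hp hq.
rewrite !(semidirectE hth hF hp hq, semidirectE hth hF hq hp).
case/andP: (hp) (hq) => /= hx hu /andP[/= hy hv].
apply: injective_projections => /=; first exact: symf.
rewrite scalerDr scalerA addrC mulnC; congr (_ + _).
rewrite mulrACA cc mul1r -signr_odd oddM.
by case: (_ && _); rewrite ?expr1 ?expr0 ?mulrNN mulr1 scale1r.
Qed.

Lemma sum_twist_even_linear alpha (alphaV : V -> V) :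
  even_linear alpha -> even_linear alphaV ->
  even_linear (sum_twist (A := A) alpha alphaV).
Proof.
move=> [lA gA] [lV gV]; split.
  move=> a p q; apply: injective_projections => /=; [exact: lA | exact: lV].
by move=> i p /andP[hx hu]; apply/andP; rewrite /= gA ?gV.
Qed.

End Semidirect.

(** * Slots of the trilinear identities *)

(** For f = br this is the Hom-Jacobi identity, for f = mu the Hom-Leibniz
    identity. *)
Definition twisted_derivation (K : fieldType) (A : superLmodType K)
    (br f : A -> A -> A) (alpha : A -> A) : Prop :=
  forall i j k x y z, x \in homog i -> y \in homog j -> z \in homog k ->
    br (alpha x) (f y z)
    = f (br x y) (alpha z) + ssign i j *: f (alpha y) (br x z).

Section Slots.
Variables (K : fieldType) (A V : superLmodType K).
Variables (alpha : A -> A) (alphaV : {linear V -> V}).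
Hypotheses (alpha_even : even_linear alpha) (alphaV_even : even_linear alphaV).
Local Notation twist := (sum_twist alpha alphaV).

Let twist_homog i x u : (x, u) \in homog i ->
  (alpha x, alphaV u) \in homog i.
Proof.
by case/andP=> hx hu; apply/andP; rewrite /= alpha_even.2 ?alphaV_even.2.
Qed.

Let inA i (x : A) : x \in homog i -> (x, 0 : V) \in homog i.
Proof. by move=> hx; apply/andP; rewrite /= hx homog0. Qed.

Let inV i (u : V) : u \in homog i -> (0 : A, u) \in homog i.
Proof. by move=> hu; apply/andP; rewrite /= hu homog0. Qed.

Section Derivation.
(* The sign c of the second product is given by a boolean exponent, so that
   all the sign identities below can be checked by cases on parities. *)
Variables (br f : A -> A -> A) (rho theta : A -> {linear V -> V}) (e : bool).
Local Notation c := ((-1) ^+ e : K).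
Variables (F G : A * V -> A * V -> A * V).
Hypotheses (hrho : even_linear_End rho) (htheta : even_linear_End theta).
Hypotheses (br_even : even_bilinear br) (f_even : even_bilinear f).
Hypotheses (hF : is_semidirect (-1) br rho F) (hG : is_semidirect c f theta G).

Let F_homog i j p q :
  p \in homog i -> q \in homog j -> F p q \in homog (i (+) j).
Proof. by case: (semidirect_even_bilinear hrho hF br_even) => _ _; apply. Qed.

Let G_homog i j p q :
  p \in homog i -> q \in homog j -> G p q \in homog (i (+) j).
Proof. by case: (semidirect_even_bilinear htheta hG f_even) => _ _; apply. Qed.

Let derivation_sides i j k x y z u v w :
    (x, u) \in homog i -> (y, v) \in homog j -> (z, w) \in homog k ->
  (F (twist (x, u)) (G (y, v) (z, w))
   = (br (alpha x) (f y z),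
      rho (alpha x) (theta y w + (c * ssign k j) *: theta z v)
      + (-1 * ssign (j (+) k) i) *: rho (f y z) (alphaV u)))
  * (G (F (x, u) (y, v)) (twist (z, w))
     + ssign i j *: G (twist (y, v)) (F (x, u) (z, w))
   = (f (br x y) (alpha z) + ssign i j *: f (alpha y) (br x z),
      theta (br x y) (alphaV w)
      + (c * ssign k (i (+) j)) *: theta (alpha z)
          (rho x v + (-1 * ssign j i) *: rho y u)
      + ssign i j *: (theta (alpha y) (rho x w + (-1 * ssign k i) *: rho z u)
          + (c * ssign (i (+) k) j) *: theta (br x z) (alphaV v)))).
Proof.
move=> hp hq hr.
have tp := twist_homog hp; have tq := twist_homog hq; have tr := twist_homog hr.
have Gqr := G_homog hq hr; have Fpq := F_homog hp hq; have Fpr := F_homog hp hr.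
move: Gqr Fpq Fpr; rewrite /sum_twist /=.
rewrite (semidirectE htheta hG hq hr) (semidirectE hrho hF hp hq).
rewrite (semidirectE hrho hF hp hr) => Gqr Fpq Fpr.
rewrite (semidirectE hrho hF tp Gqr) (semidirectE htheta hG Fpq tr).
by rewrite (semidirectE htheta hG tq Fpr).
Qed.

(** The slots of v and w both say that rho(x) is a twisted derivation of the
    action theta; the slot of u expresses rho on a product f(x, y). *)
Lemma semidirect_derivation : twisted_derivation br f alpha ->
  twisted_derivation F G twist <->
  (forall i j x y, x \in homog i -> y \in homog j -> forall v,
     rho (alpha x) (theta y v)
     = theta (br x y) (alphaV v) + ssign i j *: theta (alpha y) (rho x v)) /\
  (forall i j x y, x \in homog i -> y \in homog j -> forall v,
     rho (f x y) (alphaV v)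
     = theta (alpha x) (rho y v)
       + (c * ssign i j) *: theta (alpha y) (rho x v)).
Proof.
move=> derA; split=> [der | [act prod]].
- split=> i j x y hx hy.
    apply: (eq_on_homog (f := rho (alpha x) \o theta y)
      (g := (theta (br x y) \o alphaV)
            \+ (ssign i j \*: (theta (alpha y) \o rho x)))) => k w hw /=.
    have := der _ _ _ _ _ _ (inA hx) (inA hy) (inV hw).
    have [-> ->] := derivation_sides (inA hx) (inA hy) (inV hw).
    by move/(congr1 snd) => /=; rewrite !(linear0, scaler0, addr0).
  apply: (eq_on_homog (f := rho (f x y) \o alphaV)
    (g := (theta (alpha x) \o rho y)
          \+ ((c * ssign i j) \*: (theta (alpha y) \o rho x)))) => k u hu /=.
  have := der _ _ _ _ _ _ (inV hu) (inA hx) (inA hy).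
  have [-> ->] := derivation_sides (inV hu) (inA hx) (inA hy).
  move/(congr1 snd) => /=; rewrite !(linear0, scaler0, addr0, add0r).
  (* The coefficient of the left-hand side is its own inverse. *)
  move/(congr1 ( *:%R (-1 * ssign (i (+) j) k))).
  rewrite !linearZ /= scalerDr !scalerA addrC => E.
  transitivity (((-1 * ssign (i (+) j) k) * (-1 * ssign (i (+) j) k))
    *: rho (f x y) (alphaV u)).
    rewrite -[LHS]scale1r; congr (_ *: _).
    by case: (i) (j) k {hu E} => [] [] [] /=; ring.
  rewrite {}E -[in RHS](scale1r (theta (alpha x) _)).
  by congr (_ *: _ + _ *: _); case: (e) (i) (j) k {hu} => [] [] [] [] /=; ring.
- move=> i j k [x u] [y v] [z w] hp hq hr.
  have [-> ->] := derivation_sides hp hq hr.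
  case/andP: hp hq hr => /= hx hu /andP[/= hy hv] /andP[/= hz hw].
  apply: injective_projections => /=; first exact: derA hx hy hz.
  rewrite !(linearD, linearZ) /= (act _ _ _ _ hx hy) (act _ _ _ _ hx hz).
  rewrite (prod _ _ _ _ hy hz) !scalerDr !scalerA.
  (* Group the six terms by slot: those in w, then those in v, then in u. *)
  rewrite [RHS](AC ((1*2)*(2*1)) (1*4*(6*2)*(5*3)))%AC /=.
  by congr (_ + _ *: _ + (_ *: _ + _ *: _) + (_ *: _ + _ *: _));
    case: (e) (i) (j) (k) => [] [] [] [] /=; ring.
Qed.

End Derivation.

Section Associativity.
Variables (mu : A -> A -> A) (eta : A -> {linear V -> V}).
Variable (G : A * V -> A * V -> A * V).
Hypotheses (heta : even_linear_End eta) (mu_even : even_bilinear mu).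
Hypothesis (hG : is_semidirect 1 mu eta G).

Let G_homog i j p q :
  p \in homog i -> q \in homog j -> G p q \in homog (i (+) j).
Proof. by case: (semidirect_even_bilinear heta hG mu_even) => _ _; apply. Qed.

Let associative_sides i j k x y z u v w :
    (x, u) \in homog i -> (y, v) \in homog j -> (z, w) \in homog k ->
  (G (G (x, u) (y, v)) (twist (z, w))
   = (mu (mu x y) (alpha z),
      eta (mu x y) (alphaV w)
      + (1 * ssign k (i (+) j)) *: eta (alpha z)
          (eta x v + (1 * ssign j i) *: eta y u)))
  * (G (twist (x, u)) (G (y, v) (z, w))
   = (mu (alpha x) (mu y z),
      eta (alpha x) (eta y w + (1 * ssign k j) *: eta z v)
      + (1 * ssign (j (+) k) i) *: eta (mu y z) (alphaV u))).
Proof.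
move=> hp hq hr; have tp := twist_homog hp; have tr := twist_homog hr.
have Gqr := G_homog hq hr; have Gpq := G_homog hp hq.
move: Gqr Gpq; rewrite /sum_twist /=.
rewrite (semidirectE heta hG hq hr) (semidirectE heta hG hp hq) => Gqr Gpq.
by rewrite (semidirectE heta hG tp Gqr) (semidirectE heta hG Gpq tr).
Qed.

(** The slots of w and v are respectively the two conditions; the slot of u
    follows from both. *)
Lemma semidirect_associative :
    (forall i j k x y z, x \in homog i -> y \in homog j -> z \in homog k ->
       mu (mu x y) (alpha z) = mu (alpha x) (mu y z)) ->
  (forall i j k p q r, p \in homog i -> q \in homog j -> r \in homog k ->
     G (G p q) (twist r) = G (twist p) (G q r)) <->
  (forall i j x y, x \in homog i -> y \in homog j -> forall v,
     eta (mu x y) (alphaV v) = eta (alpha x) (eta y v)) /\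
  (forall i j x y, x \in homog i -> y \in homog j -> forall v,
     eta (alpha x) (eta y v) = ssign i j *: eta (alpha y) (eta x v)).
Proof.
move=> assA; split=> [ass | [act com]].
- split=> i j x y hx hy.
    apply: (eq_on_homog (f := eta (mu x y) \o alphaV)
      (g := eta (alpha x) \o eta y)) => k w hw /=.
    have := ass _ _ _ _ _ _ (inA hx) (inA hy) (inV hw).
    have [-> ->] := associative_sides (inA hx) (inA hy) (inV hw).
    by move/(congr1 snd) => /=; rewrite !(linear0, scaler0, addr0).
  apply: (eq_on_homog (f := eta (alpha x) \o eta y)
    (g := ssign i j \*: (eta (alpha y) \o eta x))) => k v hv /=.
  have := ass _ _ _ _ _ _ (inA hx) (inV hv) (inA hy).
  have [-> ->] := associative_sides (inA hx) (inV hv) (inA hy).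
  move/(congr1 snd) => /=; rewrite !(linear0, scaler0, addr0, add0r).
  (* The coefficient of the right-hand side is its own inverse. *)
  move/(congr1 ( *:%R (ssign j k))); rewrite !linearZ /= !scalerA => E.
  transitivity ((1 * ssign j k * ssign j k) *: eta (alpha x) (eta y v)).
    rewrite -[LHS]scale1r; congr (_ *: _).
    by case: (j) k {hv E} => [] [] /=; ring.
  rewrite -{}E; congr (_ *: _).
  by case: (i) (j) k {hv} => [] [] [] /=; ring.
- move=> i j k [x u] [y v] [z w] hp hq hr.
  have [-> ->] := associative_sides hp hq hr.
  case/andP: hp hq hr => /= hx hu /andP[/= hy hv] /andP[/= hz hw].
  apply: injective_projections => /=; first exact: assA hx hy hz.
  rewrite !(linearD, linearZ) /= (act _ _ _ _ hx hy) (act _ _ _ _ hy hz).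
  rewrite (com _ _ _ _ hz hx) (com _ _ _ _ hz hy) !scalerA addrA.
  by congr (_ + _ *: _ + _ *: _); case: (i) (j) (k) => [] [] [] /=; ring.
Qed.

End Associativity.

End Slots.

(** * Assembling the axioms *)

Theorem theorem1p2 (K : fieldType) (charK0 : [pchar K] =i pred0)
    (A : superLmodType K) (br mu : A -> A -> A) (alpha : A -> A)
    (hA : homPoisson_superalgebra br mu alpha)
    (V : superLmodType K) (alphaV : V -> V) (rho eta : A -> {linear V -> V})
    (halphaV : even_linear alphaV)
    (hrho : even_linear_End rho) (heta : even_linear_End eta) :
  homPoisson_representation br mu alpha rho eta alphaV <->
  homPoisson_superalgebra
    (sum_br br rho) (sum_mul mu eta) (sum_twist alpha alphaV).
Proof.
case: hA => [[alpha_even br_even br_skew jacA] [_ mu_even assA] mu_com leibA].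
pose aV : {linear V -> V} :=
  HB.pack alphaV (GRing.isLinear.Build K V V _ alphaV halphaV.1).
have hbr := sum_br_semidirect br rho; have hmu := sum_mul_semidirect mu eta.
have jac := semidirect_derivation (alphaV := aV) (e := true)
  alpha_even halphaV hrho hrho br_even br_even hbr hbr jacA.
have leib := semidirect_derivation (alphaV := aV) (e := false)
  alpha_even halphaV hrho heta br_even mu_even hbr hmu leibA.
have ass := semidirect_associative (alphaV := aV)
  alpha_even halphaV heta mu_even hmu assA.
split.
- case=> [[_ _ act com] [_ _ lie] eta_br rho_mu].
  have twist_even := sum_twist_even_linear alpha_even halphaV.
  split.
  + split=> //; first exact: semidirect_even_bilinear hbr br_even.
      move=> i j p q hp hq; rewrite -scaleN1r scalerA.
      apply: (semidirect_supersymmetric hrho hbr) hp hq.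
        by rewrite mulrNN mulr1.
      by move=> {}i {}j x y hx hy; rewrite -scalerA scaleN1r; apply: br_skew.
    apply/jac; split=> i j x y hx hy v.
      by rewrite (lie _ _ _ _ hx hy) subrK.
    by rewrite mulN1r scaleNr; apply: lie.
  + split=> //; first exact: semidirect_even_bilinear hmu mu_even.
    exact/ass.
  + move=> i j p q hp hq; rewrite -[ssign i j]mul1r.
    apply: (semidirect_supersymmetric heta hmu) hp hq; first exact: mulr1.
    by move=> {}i {}j x y hx hy; rewrite mul1r; apply: mu_com.
  + apply/leib; split=> i j x y hx hy v.
      by rewrite (eta_br _ _ _ _ hx hy) subrK.
    by rewrite mul1r; apply: rho_mu.
- case=> [[_ _ _ /jac[lie _]] [_ _ /ass[act com]] _ /leib[eta_br rho_mu]].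
  split=> //.
  + split=> // i j x y hx hy v.
    by apply/esym/eqP; rewrite subr_eq; apply/eqP; apply: lie.
  + move=> i j x y hx hy v.
    by apply/esym/eqP; rewrite subr_eq; apply/eqP; apply: eta_br.
  + move=> i j x y hx hy v.
    by have := rho_mu _ _ _ _ hx hy v; rewrite mul1r.
Qed.
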